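(* Let $G$ be a strongly paratopological gyrogroup. Then $G$ is topologically isomorphic to a subgyrogroup of a topological product of first-countable Hausdorff strongly paratopological gyrogroups if and only if $G$ is Hausdorff, $G$ is $\omega$-balanced, and $Hs(G)\leq\omega$.
   Context: A gyrogroup is a nonempty set $G$ with a binary operation $\oplus$ such that: (G1) there is $0\in G$ with $0\oplus x=x=x\oplus 0$ for all $x\in G$; (G2) each $x\in G$ has an inverse $\ominus x\in G$ with $\ominus x\oplus x=0=x\oplus(\ominus x)$; (G3) for all $x,y\in G$ there is an automorphism $\mathrm{gyr}[x,y]$ of $(G,\oplus)$ with $x\oplus(y\oplus z)=(x\oplus y)\oplus \mathrm{gyr}[x,y](z)$ for all $z\in G$; (G4) $\mathrm{gyr}[x\oplus y,y]=\mathrm{gyr}[x,y]$ for all $x,y\in G$. Write $a\ominus b=a\oplus(\ominus b)$ and $a\boxminus b=a\ominus\mathrm{gyr}[a,b]b$. A subgyrogroup is a nonempty subset closed under $\oplus$ and $\ominus$. Products of gyrogroups carry the coordinatewise operation; a topological isomorphism is a bijective homomorphism (a map preserving $\oplus$) that is a homeomorphism; subgyrogroups carry the subspace topology. A paratopological gyrogroup is a gyrogroup with a topology for which $\oplus:G\times G\to G$ is (jointly) continuous. It is a strongly paratopological gyrogroup if there is a neighborhood base $\mathcal U$ at $0$ such that $\mathrm{gyr}[x,y](U)=U$ for all $U\in\mathcal U$ and $x,y\in G$. No separation axioms are assumed unless stated. A family $\gamma$ of open neighborhoods of $0$ is subordinated to a neighborhood $U$ of $0$ if (1) for all $x,y\in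 G$ there is $V\in\gamma$ with $\ominus(x\oplus y)\oplus((V\oplus x)\oplus y)\subseteq U$, and (2) for all $x,y\in G$ there is $V\in\gamma$ with $V\subseteq\ominus(x\oplus y)\oplus((U\oplus x)\oplus y)$. A paratopological gyrogroup $G$ is $\omega$-balanced if for every neighborhood $U$ of $0$ there is a countable family of open neighborhoods of $0$ subordinated to $U$. (Operations on sets are elementwise.) The Hausdorff number $Hs(G)$ of a Hausdorff paratopological gyrogroup $G$ is the minimum cardinal $\kappa$ such that for every neighborhood $U$ of $0$ there is a family $\gamma$ of neighborhoods of $0$ with $|\gamma|\le\kappa$ and $\bigcap_{V\in\gamma}(V\boxminus V)\subseteq U$, where $V\boxminus V=\{a\boxminus b:a,b\in V\}$. *)

(* Defs.v *)
From HB Require Import structures.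
From mathcomp Require Import all_boot.
From mathcomp Require Import all_classical topology.

Set Implicit Arguments.
Unset Strict Implicit.
Unset Printing Implicit Defensive.

Local Open Scope classical_set_scope.
Local Open Scope card_scope.

Declare Scope gyro_scope.
Delimit Scope gyro_scope with gyro.
Local Open Scope gyro_scope.

Reserved Notation "x ⊕ y" (at level 50, left associativity).
Reserved Notation "x ⊖ y" (at level 50, left associativity).
Reserved Notation "x ⊟ y" (at level 50, left associativity).
Reserved Notation "⊖ x" (at level 35, right associativity).

(* [gzero], [gopp] and [gyr] are uniquely determined by [gadd] and the axioms,
   so carrying them as data agrees with asserting their existence. *)
HB.mixin Record isGyrogroup G := {
  gzero : G;
  gopp : G -> G;
  gadd : G -> G -> G;
  gyr : G -> G -> G -> G;
  gadd0g : left_id gzero gadd;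
  gaddg0 : right_id gzero gadd;
  gaddNg : left_inverse gzero gopp gadd;
  gaddgN : right_inverse gzero gopp gadd;
  gyr_bij : forall x y, bijective (gyr x y);
  gyr_morph : forall x y, {morph gyr x y : a b / gadd a b};
  gaddA : forall x y z, gadd x (gadd y z) = gadd (gadd x y) (gyr x y z);
  gyr_loop : forall x y, gyr (gadd x y) y =1 gyr x y
}.

#[short(type="gyrogroupType")]
HB.structure Definition Gyrogroup := {G of isGyrogroup G}.

Notation "x ⊕ y" := (gadd x y) : gyro_scope.
Notation "⊖ x" := (gopp x) : gyro_scope.
Notation "x ⊖ y" := (x ⊕ (⊖ y)) : gyro_scope.
Notation "x ⊟ y" := (x ⊖ gyr x y y) : gyro_scope.

Section GyrogroupTheory.
Context {G : gyrogroupType}.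
Implicit Types x y z : G.

Lemma gaddI x : injective (gadd x).
Proof.
move=> y z e; apply: (bij_inj (gyr_bij (⊖ x) x)).
have := congr1 (gadd (⊖ x)) e.
by rewrite !gaddA gaddNg !gadd0g.
Qed.

Lemma gyr0g x : gyr gzero x =1 id.
Proof. by move=> z; apply: (@gaddI x); rewrite -{1}[x]gadd0g -gaddA gadd0g. Qed.

Lemma gaddKg x : cancel (gadd x) (gadd (⊖ x)).
Proof.
by move=> y; rewrite gaddA gaddNg gadd0g -gyr_loop gaddNg gyr0g.
Qed.

Lemma goppK : involutive (@gopp G).
Proof. by move=> x; apply: (@gaddI (⊖ x)); rewrite gaddgN gaddNg. Qed.

Lemma gaddNKg x : cancel (gadd (⊖ x)) (gadd x).
Proof. by move=> y; have := gaddKg (⊖ x) y; rewrite goppK. Qed.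

Lemma gyrE x y z : gyr x y z = ⊖ (x ⊕ y) ⊕ (x ⊕ (y ⊕ z)).
Proof. by rewrite (gaddA x y z) gaddKg. Qed.

Definition gyrV x y z : G := ⊖ y ⊕ (⊖ x ⊕ ((x ⊕ y) ⊕ z)).

Lemma gyrK x y : cancel (gyr x y) (gyrV x y).
Proof. by move=> z; rewrite /gyrV -gaddA !gaddKg. Qed.

Lemma gyrVK x y : cancel (gyrV x y) (gyr x y).
Proof. by move=> z; rewrite gyrE /gyrV !gaddNKg gaddKg. Qed.

End GyrogroupTheory.

Record subgyrogroup (G : gyrogroupType) := Subgyrogroup {
  subgyro_set :> set G;
  subgyro_neq0 : subgyro_set !=set0;
  subgyroD : forall x y, subgyro_set x -> subgyro_set y -> subgyro_set (x ⊕ y);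
  subgyroN : forall x, subgyro_set x -> subgyro_set (⊖ x)
}.

Section SubGyrogroup.
Context (G : gyrogroupType) (S : subgyrogroup G).
Local Notation A := (subgyro_set S).
Implicit Types x y z : A.

Lemma subgyro0 : A gzero.
Proof.
have [x Ax] := subgyro_neq0 S.
by rewrite -(gaddNg x); apply: subgyroD => //; apply: subgyroN.
Qed.

Lemma subgyro_gyr (x y z : G) : A x -> A y -> A z -> A (gyr x y z).
Proof.
move=> Ax Ay Az; rewrite gyrE.
by do ?[apply: subgyroN | apply: subgyroD].
Qed.

Lemma subgyro_gyrV (x y z : G) : A x -> A y -> A z -> A (gyrV x y z).
Proof. by move=> Ax Ay Az; do ?[apply: subgyroN | apply: subgyroD]. Qed.

Definition sub_gzero : A := exist _ gzero (mem_set subgyro0).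
Definition sub_gopp x : A :=
  exist _ (⊖ val x) (mem_set (subgyroN (set_valP x))).
Definition sub_gadd x y : A :=
  exist _ (val x ⊕ val y) (mem_set (subgyroD (set_valP x) (set_valP y))).
Definition sub_gyr x y z : A :=
  exist _ (gyr (val x) (val y) (val z))
    (mem_set (subgyro_gyr (set_valP x) (set_valP y) (set_valP z))).
Definition sub_gyrV x y z : A :=
  exist _ (gyrV (val x) (val y) (val z))
    (mem_set (subgyro_gyrV (set_valP x) (set_valP y) (set_valP z))).

Let add0 : left_id sub_gzero sub_gadd.
Proof. by move=> x; apply: val_inj; rewrite /= gadd0g. Qed.
Let addr0 : right_id sub_gzero sub_gadd.
Proof. by move=> x; apply: val_inj; rewrite /= gaddg0. Qed.
Let addN : left_inverse sub_gzero sub_gopp sub_gadd.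
Proof. by move=> x; apply: val_inj; rewrite /= gaddNg. Qed.
Let addrN : right_inverse sub_gzero sub_gopp sub_gadd.
Proof. by move=> x; apply: val_inj; rewrite /= gaddgN. Qed.
Let bij x y : bijective (sub_gyr x y).
Proof.
exists (sub_gyrV x y) => z; apply: val_inj => /=.
  exact: gyrK.
exact: gyrVK.
Qed.
Let morph x y : {morph sub_gyr x y : a b / sub_gadd a b}.
Proof. by move=> a b; apply: val_inj; rewrite /= gyr_morph. Qed.
Let addA x y z : sub_gadd x (sub_gadd y z) = sub_gadd (sub_gadd x y) (sub_gyr x y z).
Proof. by apply: val_inj; rewrite /= gaddA. Qed.
Let loop x y : sub_gyr (sub_gadd x y) y =1 sub_gyr x y.
Proof. by move=> z; apply: val_inj; rewrite /= gyr_loop. Qed.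

HB.instance Definition _ := isGyrogroup.Build (set_type A)
  add0 addr0 addN addrN bij morph addA loop.

End SubGyrogroup.

Section ProductGyrogroup.
Context (I : Type) (H : I -> gyrogroupType).
Implicit Types x y z : prod_topology H.

Definition prod_gzero : prod_topology H := fun=> gzero.
Definition prod_gopp x : prod_topology H := fun i => ⊖ x i.
Definition prod_gadd x y : prod_topology H := fun i => x i ⊕ y i.
Definition prod_gyr x y z : prod_topology H := fun i => gyr (x i) (y i) (z i).

Let add0 : left_id prod_gzero prod_gadd.
Proof. by move=> x; apply: functional_extensionality_dep => i; apply: gadd0g. Qed.
Let addr0 : right_id prod_gzero prod_gadd.
Proof. by move=> x; apply: functional_extensionality_dep => i; apply: gaddg0. Qed.
Let addN : left_inverse prod_gzero prod_gopp prod_gadd.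
Proof. by move=> x; apply: functional_extensionality_dep => i; apply: gaddNg. Qed.
Let addrN : right_inverse prod_gzero prod_gopp prod_gadd.
Proof. by move=> x; apply: functional_extensionality_dep => i; apply: gaddgN. Qed.
Let bij x y : bijective (prod_gyr x y).
Proof.
exists (fun z i => gyrV (x i) (y i) (z i)) => z;
  apply: functional_extensionality_dep => i.
  exact: gyrK.
exact: gyrVK.
Qed.
Let morph x y : {morph prod_gyr x y : a b / prod_gadd a b}.
Proof.
by move=> a b; apply: functional_extensionality_dep => i; apply: gyr_morph.
Qed.
Let addA x y z :
  prod_gadd x (prod_gadd y z) = prod_gadd (prod_gadd x y) (prod_gyr x y z).
Proof. by apply: functional_extensionality_dep => i; apply: gaddA. Qed.
Let loop x y : prod_gyr (prod_gadd x y) y =1 prod_gyr x y.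
Proof.
by move=> z; apply: functional_extensionality_dep => i; apply: gyr_loop.
Qed.

HB.instance Definition _ := isGyrogroup.Build (prod_topology H)
  add0 addr0 addN addrN bij morph addA loop.

End ProductGyrogroup.

(* A gyrogroup and a topology on the same carrier, with no compatibility. *)
#[short(type="topologizedGyrogroupType")]
HB.structure Definition TopologizedGyrogroup :=
  {G of Gyrogroup G & Topological G}.

HB.instance Definition _ (G : topologizedGyrogroupType) (A : subgyrogroup G) :=
  Gyrogroup.on (set_type A).

HB.instance Definition _ (I : Type) (H : I -> topologizedGyrogroupType) :=
  Gyrogroup.on (prod_topology H).

Definition nbhs_base (T : topologicalType) (x : T) (B : set (set T)) :=
  B `<=` nbhs x /\ filter_from B id --> x.

Definition first_countable (T : topologicalType) :=
  forall x : T, exists2 B, countable B & nbhs_base x B.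

HB.mixin Record isParatopologicalGyrogroup G
    & Gyrogroup G & Topological G := {
  gadd_continuous : continuous (fun p : G * G => p.1 ⊕ p.2)
}.

#[short(type="paratopologicalGyrogroupType")]
HB.structure Definition ParatopologicalGyrogroup :=
  {G of TopologizedGyrogroup G & isParatopologicalGyrogroup G}.

HB.mixin Record isStronglyParatopologicalGyrogroup G
    & ParatopologicalGyrogroup G := {
  gyr_invariant_base : exists2 B : set (set G), nbhs_base gzero B &
    forall U, B U -> forall x y : G, gyr x y @` U = U
}.

#[short(type="stronglyParatopologicalGyrogroupType")]
HB.structure Definition StronglyParatopologicalGyrogroup :=
  {G of ParatopologicalGyrogroup G & isStronglyParatopologicalGyrogroup G}.

Definition topologically_isomorphic (G H : topologizedGyrogroupType) :=
  exists (f : G -> H) (g : H -> G),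
    [/\ cancel f g, cancel g f, {morph f : x y / x ⊕ y},
        continuous f & continuous g].

Section ParatopologicalNotions.
Context (G : paratopologicalGyrogroupType).

Definition subordinated (gamma : set (set G)) (U : set G) :=
  (forall x y : G, exists2 V, gamma V &
     [set ⊖ (x ⊕ y) ⊕ ((v ⊕ x) ⊕ y) | v in V] `<=` U) /\
  (forall x y : G, exists2 V, gamma V &
     V `<=` [set ⊖ (x ⊕ y) ⊕ ((u ⊕ x) ⊕ y) | u in U]).

Definition omega_balanced :=
  forall U : set G, nbhs gzero U ->
    exists gamma : set (set G),
      [/\ countable gamma, gamma `<=` open_nbhs gzero & subordinated gamma U].

(* Cardinals are represented by sets, compared by [#<=]. *)
Definition hausdorff_number_bound {T : Type} (K : set T) :=
  forall U : set G, nbhs gzero U ->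
    exists gamma : set (set G),
      [/\ gamma #<= K, gamma `<=` nbhs gzero &
          \bigcap_(V in gamma) [set a ⊟ b | a in V & b in V] `<=` U].

Definition is_hausdorff_number {T : Type} (K : set T) :=
  hausdorff_number_bound K /\
  forall (T' : Type) (K' : set T'), hausdorff_number_bound K' -> K #<= K'.

Definition hausdorff_number_le {T : Type} (K : set T) :=
  exists (T' : Type) (K' : set T'), is_hausdorff_number K' /\ K' #<= K.

End ParatopologicalNotions.

Arguments omega_balanced : clear implicits.
Arguments hausdorff_number_le G {T} K.
Arguments is_hausdorff_number G {T} K.
Arguments hausdorff_number_bound G {T} K.

(* Main.v *)
(* Left Bol's identity writes the inverse of a right translation as a product of
   translations, so in any paratopological gyrogroup the maps
   u |-> ⊖(x ⊕ y) ⊕ ((u ⊕ x) ⊕ y) are homeomorphisms fixing 0; hence a countable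
   base at 0 is subordinated to every neighbourhood of 0. Moreover V ⊟ V consists
   of the c such that c ⊕ V meets V, so Hausdorffness makes these sets intersect
   in {0}. Both properties pass to subgyrogroups of products because the
   neighbourhoods satisfying them form a filter. Conversely, given U, the
   hypotheses yield a decreasing sequence of gyr-invariant neighbourhoods of 0,
   some of them inside U, that is a base at 0 of a coarser strongly
   paratopological gyrogroup topology. The bound on Hs(G) makes the Kolmogorov
   quotient of that topology Hausdorff, and G embeds diagonally in the product of
   these quotients over all U. *)
From HB Require Import structures.
Require Import Defs.
From mathcomp Require Import all_boot generic_quotient all_classical topology.

Set Implicit Arguments.
Unset Strict Implicit.
Unset Printing Implicit Defensive.

Local Open Scope classical_set_scope.
Local Open Scope card_scope.
Local Open Scope gyro_scope.

(** * Gyrogroup identities: Bol, right division and shifts *)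

Section GyrogroupAlgebra.
Context {G : gyrogroupType}.
Implicit Types a b c u w x y z : G.

Lemma gopp0 : ⊖ (gzero : G) = gzero.
Proof. by rewrite -[RHS](gaddgN (gzero : G)) gadd0g. Qed.

Lemma gyr0 x y : gyr x y gzero = gzero.
Proof. by rewrite gyrE gaddg0 gaddNg. Qed.

Lemma gyrN x y z : gyr x y (⊖ z) = ⊖ gyr x y z.
Proof. by apply: (@gaddI _ (gyr x y z)); rewrite -gyr_morph !gaddgN gyr0. Qed.

Lemma gsubDl a x y : ⊖ (a ⊕ x) ⊕ (a ⊕ y) = gyr a x (⊖ x ⊕ y).
Proof. by rewrite gyrE gaddNKg. Qed.

(* The loop property at the pair (⊖ u, u ⊕ c), whose sum is c, is the left Bol
   identity once the gyrations are expanded. *)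
Lemma left_bol c u z : c ⊕ (u ⊕ (c ⊕ z)) = (c ⊕ (u ⊕ c)) ⊕ z.
Proof.
have := gyr_loop (⊖ u) (u ⊕ c) (gyr u c z).
rewrite gaddKg [LHS]gyrE [RHS]gyrE -gaddA !gaddKg => e.
by rewrite -[in RHS]e gaddNKg.
Qed.

(* Left Bol gives R_x L_(⊖x) R_(⊖x) = L_(⊖x), so right translation has the inverse
   R_x^-1 = L_(⊖x) R_(⊖x) L_x, which is continuous even though ⊖ need not be. *)
Definition rsub x b : G := ⊖ x ⊕ ((x ⊕ b) ⊖ x).

Lemma rsubK x : cancel (rsub x) (gadd^~ x).
Proof. by move=> b; rewrite /rsub -left_bol gaddNg gaddg0 gaddKg. Qed.

Lemma raddK x : cancel (gadd^~ x) (rsub x).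
Proof.
move=> u; rewrite /rsub; apply: (@gaddI _ x); rewrite gaddNKg.
(* At [⊖ x], [rsubK] unfolds to the remaining goal, since [⊖ x ⊕ (x ⊕ u)] cancels. *)
have := rsubK (⊖ x) (x ⊕ u); rewrite /rsub goppK gaddKg /= => e.
by rewrite e.
Qed.

(** [⊟] is right division: the loop property replaces [gyr (d ⊕ b) b] by [gyr d b], so that [gaddA]
    cancels [b]; conversely every [a] is a right translate by [b]. *)
Lemma cosub_eq a b c : (a ⊟ b = c) <-> (c ⊕ b = a).
Proof.
have cobK d : (d ⊕ b) ⊟ b = d.
  by rewrite -gyrN gyr_loop -gaddA gaddgN gaddg0.
split=> [<-|<-]; last exact: cobK.
by rewrite -{1 2}(rsubK b a) /= cobK (rsubK b a).
Qed.

(** The maps of [subordinated]; in a group, conjugation by [x ⊕ y]. *)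
Definition shift x y u : G := ⊖ (x ⊕ y) ⊕ ((u ⊕ x) ⊕ y).

Definition shiftV x y w : G := rsub x (rsub y ((x ⊕ y) ⊕ w)).

Lemma shiftK x y : cancel (shift x y) (shiftV x y).
Proof. by move=> u; rewrite /shiftV /shift gaddNKg !raddK. Qed.

Lemma shiftVK x y : cancel (shiftV x y) (shift x y).
Proof.
move=> w; rewrite /shiftV /shift.
by have /= -> := rsubK x; have /= -> := rsubK y; rewrite gaddKg.
Qed.

Lemma shift0 x y : shift x y gzero = gzero.
Proof. by rewrite /shift gadd0g gaddNg. Qed.

Lemma shiftV0 x y : shiftV x y gzero = gzero.
Proof. by rewrite -{1}(shift0 x y) shiftK. Qed.

(** Turns the images in [subordinated] into preimages, to which continuity and morphisms apply
    directly. *)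
Lemma image_shift x y (U : set G) : shift x y @` U = shiftV x y @^-1` U.
Proof.
rewrite eqEsubset; split=> [_ [u Uu <-]|w Uw]; first by rewrite /= shiftK.
by exists (shiftV x y w) => //; rewrite shiftVK.
Qed.

End GyrogroupAlgebra.

(** * The quotient gyrogroup attached to a null sequence *)

(* A countable base at 0 of a first-countable strongly paratopological gyrogroup
   topology on G whose Kolmogorov quotient is Hausdorff; [nullseq_sep] says that
   the intersection of the sets V ⊟ V is that of the sets V. *)
Record nullseq (G : gyrogroupType) := Nullseq {
  nullset :> nat -> set G;
  nullseq0 : forall n, nullset n gzero;
  nullseq_decr : forall m n, m <= n -> nullset n `<=` nullset m;
  nullseq_gyr : forall n x y z, nullset n (gyr x y z) <-> nullset n z;
  nullseqD : forall n, exists m, forall v w,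
    nullset m v -> nullset m w -> nullset n (v ⊕ w);
  nullseq_shift : forall n x y, exists m,
    nullset m `<=` shift x y @^-1` nullset n;
  nullseq_shiftV : forall n x y, exists m,
    nullset m `<=` shift x y @` nullset n;
  nullseq_sep : forall c,
    (forall m, exists2 b, nullset m b & nullset m (c ⊕ b)) ->
    forall n, nullset n c
}.

(* The given topology of G plays no role here; the structure only provides the
   [choiceType] that generic quotients need. *)
Section NullseqTopology.
Context {G : topologizedGyrogroupType} (V : nullseq G).
Implicit Types a x y z : G.

(** As a set, [near_at n x] is the left translate of [V n] by [x]. *)
Definition near_at n x y := V n (⊖ x ⊕ y).

Lemma near_at_decr m n x y : m <= n -> near_at n x y -> near_at m x y.
Proof. by move=> /nullseq_decr; apply. Qed.

Lemma near_at_refl n x : near_at n x x.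
Proof. by rewrite /near_at gaddNg; apply: nullseq0. Qed.

(** By [gsubDl] the two differences are related by a gyration, which preserves [V n]. *)
Lemma near_at_add2l n a x y : near_at n (a ⊕ x) (a ⊕ y) <-> near_at n x y.
Proof. by rewrite /near_at gsubDl; apply: nullseq_gyr. Qed.

(** Translating the second pair by [⊖ x] exhibits [⊖ x ⊕ z] as a sum of two elements of [V m]. *)
Lemma near_at_trans n : exists m, forall x y z,
  near_at m x y -> near_at m y z -> near_at n x z.
Proof.
have [m Vm] := nullseqD V n; exists m => x y z xy.
move=> /(near_at_add2l _ (⊖ x)) yz.
by rewrite /near_at -(gaddNKg (⊖ x ⊕ y) (⊖ x ⊕ z)); apply: Vm.
Qed.

(* [shift x gzero] turns x ⊕ v into v' ⊕ x. *)
Lemma near_at_add2r n x a : exists m, forall x',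
  near_at m x x' -> near_at n (x ⊕ a) (x' ⊕ a).
Proof.
have [k Vk] := nullseq_shift V n x a.
have [m Vm] := nullseq_shiftV V k x gzero.
exists m => x' /Vm [v /Vk Vv]; rewrite /shift !gaddg0 => /gaddI <-.
exact: Vv.
Qed.

Lemma near_at_add n x a : exists m, forall x' a',
  near_at m x x' -> near_at m a a' -> near_at n (x ⊕ a) (x' ⊕ a').
Proof.
have [k Hk] := near_at_trans n; have [m Hm] := near_at_add2r k x a.
exists (maxn k m) => x' a' xx' aa'; apply: (Hk _ (x' ⊕ a)).
  by apply: Hm; apply: near_at_decr xx'; apply: leq_maxr.
by apply/near_at_add2l; apply: near_at_decr aa'; apply: leq_maxl.
Qed.

Definition inseparable x y := `[< forall n, near_at n x y >].

Lemma inseparable_refl : reflexive inseparable.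
Proof. by move=> x; apply/asboolP => n; apply: near_at_refl. Qed.

Lemma inseparable_trans : transitive inseparable.
Proof.
move=> y x z /asboolP xy /asboolP yz; apply/asboolP => n.
by have [m Hm] := near_at_trans n; apply: Hm (xy m) (yz m).
Qed.

(** The sets [V n] may fail to be symmetric; [nullseq_sep] makes up for it. With [c = ⊖ y ⊕ x], the
    chosen [b] satisfies [c ⊕ b = gzero]. *)
Lemma inseparable_symW x y : inseparable x y -> inseparable y x.
Proof.
move=> /asboolP xy; apply/asboolP; apply: nullseq_sep => m.
exists (gyr (⊖ y) x (⊖ x ⊕ y)); first by apply/nullseq_gyr; apply: xy.
by rewrite -gaddA gaddNKg gaddNg; apply: nullseq0.
Qed.

Lemma inseparable_sym : symmetric inseparable.
Proof. by move=> x y; apply/idP/idP => /inseparable_symW. Qed.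

Canonical inseparable_equiv :=
  EquivRel inseparable inseparable_refl inseparable_sym inseparable_trans.

Lemma inseparable_add x x' y y' : inseparable x x' -> inseparable y y' ->
  inseparable (x ⊕ y) (x' ⊕ y').
Proof.
move=> /asboolP xx' /asboolP yy'; apply/asboolP => n.
by have [m Hm] := near_at_add n x y; apply: Hm (xx' m) (yy' m).
Qed.

(** Deduced from compatibility with [⊕] alone: add [⊖ x'] on the right, then [⊖ x] on the left. *)
Lemma inseparable_opp x x' : inseparable x x' -> inseparable (⊖ x) (⊖ x').
Proof.
move=> xx'.
have := inseparable_add xx' (inseparable_refl (⊖ x')).
rewrite gaddgN => /(inseparable_add (inseparable_refl (⊖ x))).
by rewrite gaddKg gaddg0 inseparable_sym.
Qed.

Definition kquot : Type := {eq_quot inseparable}%qT.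
HB.instance Definition _ := Choice.on kquot.
HB.instance Definition _ := EqQuotient.on kquot.

Definition kpi (x : G) : kquot := (\pi_kquot x)%qT.
Definition krepr (q : kquot) : G := repr q.

Lemma kreprK : cancel krepr kpi. Proof. exact: reprK. Qed.

Lemma kpi_eq x y : kpi x = kpi y <-> inseparable x y.
Proof. by split=> [|xy]; [move/eqquotP | apply/eqquotP]. Qed.

Lemma krepr_kpi x : inseparable (krepr (kpi x)) x.
Proof. by apply/kpi_eq; rewrite kreprK. Qed.

Definition kzero := kpi gzero.
Definition kopp p := kpi (⊖ krepr p).
Definition kadd p q := kpi (krepr p ⊕ krepr q).
Definition kgyr p q r := kpi (gyr (krepr p) (krepr q) (krepr r)).

Lemma kpiN x : kpi (⊖ x) = kopp (kpi x).
Proof.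
by apply/kpi_eq; apply: inseparable_opp; rewrite inseparable_sym krepr_kpi.
Qed.

Lemma kpiD x y : kpi (x ⊕ y) = kadd (kpi x) (kpi y).
Proof.
by apply/kpi_eq; apply: inseparable_add; rewrite inseparable_sym krepr_kpi.
Qed.

(** By [gyrE] a gyration is a word in [⊕] and [⊖], both compatible with [kpi]. *)
Lemma kpi_gyr x y z : kpi (gyr x y z) = kgyr (kpi x) (kpi y) (kpi z).
Proof. by rewrite /kgyr !gyrE !(kpiD, kpiN) !kreprK. Qed.

Definition kgyrV p q r := kpi (gyrV (krepr p) (krepr q) (krepr r)).

Let kadd0 : left_id kzero kadd.
Proof. by move=> p; rewrite -(kreprK p) -kpiD gadd0g. Qed.
Let kaddr0 : right_id kzero kadd.
Proof. by move=> p; rewrite -(kreprK p) -kpiD gaddg0. Qed.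
Let kaddN : left_inverse kzero kopp kadd.
Proof. by move=> p; rewrite -(kreprK p) -kpiN -kpiD gaddNg. Qed.
Let kaddrN : right_inverse kzero kopp kadd.
Proof. by move=> p; rewrite -(kreprK p) -kpiN -kpiD gaddgN. Qed.
Let kgyr_bij p q : bijective (kgyr p q).
Proof.
exists (kgyrV p q) => r; rewrite /kgyrV -{2}(kreprK r).
  rewrite /gyrV !(kpiD, kpiN) !kreprK.
  by rewrite -(kreprK p) -(kreprK q) -(kreprK r) -kpi_gyr -!(kpiD, kpiN)
    -[X in kpi X]/(gyrV _ _ _) gyrK.
rewrite -{1}(kreprK p) -{1}(kreprK q) -kpi_gyr.
by rewrite gyrVK.
Qed.
Let kgyr_morph p q : {morph kgyr p q : a b / kadd a b}.
Proof.
move=> a b; rewrite -(kreprK a) -(kreprK b) -(kreprK p) -(kreprK q).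
by rewrite -kpiD -!kpi_gyr gyr_morph kpiD.
Qed.
Let kaddA p q r : kadd p (kadd q r) = kadd (kadd p q) (kgyr p q r).
Proof.
rewrite -(kreprK r) -(kreprK p) -(kreprK q).
by rewrite -kpi_gyr -!kpiD gaddA.
Qed.
Let kgyr_loop p q : kgyr (kadd p q) q =1 kgyr p q.
Proof.
move=> r; rewrite -(kreprK r) -(kreprK p) -(kreprK q).
by rewrite -kpiD -!kpi_gyr gyr_loop.
Qed.

HB.instance Definition _ := isGyrogroup.Build kquot
  kadd0 kaddr0 kaddN kaddrN kgyr_bij kgyr_morph kaddA kgyr_loop.

Definition knbhs (p : kquot) : set_system kquot :=
  [set A | exists n, near_at n (krepr p) `<=` kpi @^-1` A].

(** Inseparable points are near at every level, so [near_at_trans] absorbs a change of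
    representative. *)
Lemma knbhsE x A :
  knbhs (kpi x) A <-> exists n, near_at n x `<=` kpi @^-1` A.
Proof.
have /asboolP repx := krepr_kpi x.
have /asboolP xrep : inseparable x (krepr (kpi x)).
  by rewrite inseparable_sym krepr_kpi.
by split=> -[n An]; have [m Hm] := near_at_trans n; exists m => y xy;
  apply: An; apply: Hm xy.
Qed.

Let knbhs_filter p : ProperFilter (knbhs p).
Proof.
split; first by case=> n /(_ _ (near_at_refl _ _)).
split; first by exists 0.
  move=> A B [m Am] [n Bn]; exists (maxn m n) => y py; split.
    by apply: Am; apply: near_at_decr py; apply: leq_maxl.
  by apply: Bn; apply: near_at_decr py; apply: leq_maxr.
by move=> A B AB [n An]; exists n => y /An /AB.
Qed.
Let knbhs_singleton p A : knbhs p A -> A p.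
Proof. by case=> n An; rewrite -(kreprK p); apply: An; apply: near_at_refl. Qed.
Let knbhs_nbhs p A : knbhs p A -> knbhs p (knbhs^~ A).
Proof.
case=> n An; have [m Hm] := near_at_trans n.
exists m => y py; apply/knbhsE; exists m => z yz.
by apply: An; apply: Hm py yz.
Qed.

HB.instance Definition _ := hasNbhs.Build kquot knbhs.
HB.instance Definition _ := Nbhs_isNbhsTopological.Build kquot
  knbhs_filter knbhs_singleton knbhs_nbhs.

Lemma nbhs_kpi x (A : set kquot) :
  nbhs (kpi x) A <-> exists n, near_at n x `<=` kpi @^-1` A.
Proof. exact: knbhsE. Qed.

Let kadd_continuous : continuous (fun p : kquot * kquot => p.1 ⊕ p.2).
Proof.
move=> [p q] A /=; rewrite -(kreprK p) -(kreprK q).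
rewrite -[kpi _ ⊕ kpi _]kpiD => /nbhs_kpi [n An].
have [m Hm] := near_at_add n (krepr p) (krepr q).
exists ([set kpi y | y in near_at m (krepr p)],
        [set kpi y | y in near_at m (krepr q)]).
  by split; apply/nbhs_kpi; exists m => y ? /=; exists y.
move=> [_ _] [/= [y py <-] [z qz <-]].
by rewrite -[kpi _ ⊕ kpi _]kpiD; apply: An; apply: Hm.
Qed.

HB.instance Definition _ :=
  isParatopologicalGyrogroup.Build kquot kadd_continuous.

Lemma kpi_nbhs_base x : nbhs_base (kpi x) (range (fun n => kpi @` near_at n x)).
Proof.
split=> [_ [n _ <-]|A /nbhs_kpi [n An]].
  by apply/nbhs_kpi; exists n => y ? /=; exists y.
by exists (kpi @` near_at n x); [exists n | move=> _ [y /An ? <-]].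
Qed.

Let kgyr_invariant : exists2 B : set (set kquot), nbhs_base gzero B &
  forall U, B U -> forall p q : kquot, gyr p q @` U = U.
Proof.
exists (range (fun n => kpi @` near_at n gzero)); first exact: kpi_nbhs_base.
move=> _ [n _ <-] p q; have near0 z : near_at n gzero z <-> V n z.
  by rewrite /near_at gopp0 gadd0g.
rewrite -(kreprK p) -(kreprK q) eqEsubset; split.
  move=> _ [_ [z /near0 Vz <-] <-].
  rewrite -[gyr _ _ _]kpi_gyr; eexists; last by [].
  by apply/near0/nullseq_gyr.
move=> _ [z /near0 Vz <-]; exists (kpi (gyrV (krepr p) (krepr q) z)).
  eexists; last by [].
  by apply/near0/(nullseq_gyr _ _ (krepr p) (krepr q)); rewrite gyrVK.
by rewrite -[gyr _ _ _]kpi_gyr gyrVK.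
Qed.

HB.instance Definition _ :=
  isStronglyParatopologicalGyrogroup.Build kquot kgyr_invariant.

Lemma kquot_first_countable : first_countable kquot.
Proof.
move=> p; rewrite -(kreprK p); eexists; last exact: kpi_nbhs_base.
exact: card_image_le.
Qed.

(** If basic neighbourhoods of the two classes meet, some [t] is near both [x] and [y]. Then a
    gyration [b] of [⊖ y ⊕ t] and the sum [(⊖ x ⊕ y) ⊕ b = ⊖ x ⊕ t] both lie in [V n], as
    [nullseq_sep] requires. *)
Lemma kquot_hausdorff : hausdorff_space kquot.
Proof.
move=> p q; rewrite -(kreprK p) -(kreprK q).
set x := krepr p; set y := krepr q => clpq.
apply/kpi_eq; apply/asboolP; apply: nullseq_sep => n.
have [m Hm] := near_at_trans n.
have nbhs_near z : nbhs (kpi z) (kpi @` near_at m z).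
  by apply/nbhs_kpi; exists m => t ?; exists t.
have [_ [[s xs <-] [t yt]]] := clpq _ _ (nbhs_near x) (nbhs_near y).
move=> /esym/kpi_eq/asboolP /(_ m) st.
exists (gyr (⊖ x) y (⊖ y ⊕ t)).
  apply/nullseq_gyr; have : near_at n y t by exact: Hm (near_at_refl _ _) yt.
  by [].
rewrite -gaddA gaddNKg; exact: Hm xs st.
Qed.

End NullseqTopology.

(** * Enumerations and finite intersections *)

(** The default [d] fills the indices that code no element, so empty and finite sets are covered
    too. *)
Lemma countable_enum T (d : T) (A : set T) : countable A ->
  exists e : nat -> T,
    (forall k, A (e k) \/ e k = d) /\ forall a, A a -> exists k, e k = a.
Proof.
move=> /countable_injP[f finj].
have /choice[e eP] k : exists b,
    (A b \/ b = d) /\ forall a, A a -> f a = k -> b = a.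
  have [[b [Ab fb]]|nob] := pselect (exists b, A b /\ f b = k).
    exists b; split=> [|a Aa fa]; first by left.
    by apply: finj; rewrite ?inE // fb fa.
  by exists d; split=> [|a Aa fa]; [right | case: nob; exists a].
exists e; split=> [k|a Aa]; first by have [] := eP k.
by exists (f a); have [_] := eP (f a); apply.
Qed.

Lemma uniform_bound (Q : nat -> nat -> Prop) :
  (forall k m m', m <= m' -> Q k m -> Q k m') -> (forall k, exists m, Q k m) ->
  forall n, exists m, forall k, k <= n -> Q k m.
Proof.
move=> Qmono Qex; elim=> [|n [m Hm]].
  by have [m Q0] := Qex 0; exists m => k; rewrite leqn0 => /eqP ->.
have [m' Qm'] := Qex n.+1; exists (maxn m m') => k.
rewrite leq_eqVlt => /predU1P[->|]; first exact: Qmono (leq_maxr _ _) Qm'.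
by rewrite ltnS => /Hm; apply: Qmono; apply: leq_maxl.
Qed.

Section InitialCaps.
Context {T : Type} (e : nat -> set T).

(** The bound [n.+1] includes [e n] itself, so [capn n] lies in [e n]. *)
Definition capn n := \bigcap_(k < n.+1) e k.

Lemma capn_decr m n : m <= n -> capn n `<=` capn m.
Proof. by move=> mn x ex k /= km; apply: ex; apply: leq_trans km _. Qed.

Lemma capn_closed (P : set (set T)) :
  (forall A B, P A -> P B -> P (A `&` B)) -> (forall k, P (e k)) ->
  forall n, P (capn n).
Proof.
move=> PI Pe; elim=> [|n IHn].
  by rewrite /capn bigcap_mkord big_ord_recr big_ord0 /= setTI.
by rewrite /capn bigcap_mkord big_ord_recr -bigcap_mkord; apply: PI.
Qed.

End InitialCaps.

Lemma nbhs_preimage (S T : topologicalType) (f : S -> T) (x : S) (A : set T) :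
  continuous f -> nbhs (f x) A -> nbhs x (f @^-1` A).
Proof. by move=> cf; apply: cf. Qed.

Lemma first_countable_decr (T : topologicalType) (x : T) : first_countable T ->
  exists O : nat -> set T, [/\ forall n, open_nbhs x (O n),
    forall m n, m <= n -> O n `<=` O m &
    forall A, nbhs x A -> exists n, O n `<=` A].
Proof.
move=> /(_ x) [B /(countable_enum setT)[e [eB Be]] [Bx xB]].
have ex k : nbhs x (e k) by case: (eB k) => [/Bx|->] //; apply: filterT.
exists (capn (fun k => (e k)°)); split.
- apply: capn_closed => [A A'|k]; first exact: open_nbhsI.
  by split; [apply: open_interior | apply: ex].
- by move=> m n; apply: capn_decr.
- move=> A /xB [b Bb bA]; have [k ekb] := Be b Bb; exists k.
  move=> z ez; apply: bA; rewrite -ekb; apply: interior_subset.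
  exact: ez (ltnSn k).
Qed.

(** * Morphisms, translations and controlled neighbourhoods *)

Section GyrogroupMorphism.
Context (G H : gyrogroupType) (f : G -> H).
Hypothesis fD : {morph f : x y / x ⊕ y}.

Lemma gmorph0 : f gzero = gzero.
Proof. by apply: (@gaddI _ (f gzero)); rewrite -fD !gaddg0. Qed.

Lemma gmorphN : {morph f : x / ⊖ x}.
Proof.
by move=> x; apply: (@gaddI _ (f x)); rewrite -fD !gaddgN gmorph0.
Qed.

Lemma gmorph_shift x y : {morph f : u / shift x y u >-> shift (f x) (f y) u}.
Proof. by move=> u; rewrite /shift !(fD, gmorphN). Qed.

Lemma gmorph_shiftV x y : {morph f : u / shiftV x y u >-> shiftV (f x) (f y) u}.
Proof. by move=> u; rewrite /shiftV /rsub !(fD, gmorphN). Qed.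

End GyrogroupMorphism.

Section Paratopological.
Context {G : paratopologicalGyrogroupType}.
Implicit Types x y z : G.

Lemma nbhs_add x y A : nbhs (x ⊕ y) A ->
  exists U W, [/\ nbhs x U, nbhs y W & forall u w, U u -> W w -> A (u ⊕ w)].
Proof.
move=> /(@gadd_continuous G (x, y)) [[U W] [/= xU yW] UWA].
by exists U, W; split=> // u w Uu Ww; apply: (UWA (u, w)).
Qed.

Lemma ladd_continuous x : continuous (gadd x).
Proof.
move=> y A /nbhs_add [U [W [xU yW UWA]]].
by apply: filterS yW => w; apply: UWA; apply: nbhs_singleton.
Qed.

Lemma radd_continuous x : continuous (gadd^~ x).
Proof.
move=> y A /nbhs_add [U [W [xU yW UWA]]].
by apply: filterS xU => w Uw; apply: UWA => //; apply: nbhs_singleton.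
Qed.

Lemma rsub_continuous x : continuous (@rsub G x).
Proof.
move=> b; exact: continuous_comp (continuous_comp (@ladd_continuous x b)
  (@radd_continuous (⊖ x) _)) (@ladd_continuous (⊖ x) _).
Qed.

Lemma shift_continuous x y : continuous (@shift G x y).
Proof.
move=> b; exact: continuous_comp (continuous_comp (@radd_continuous x b)
  (@radd_continuous y _)) (@ladd_continuous (⊖ (x ⊕ y)) _).
Qed.

Lemma shiftV_continuous x y : continuous (@shiftV G x y).
Proof.
move=> b; exact: continuous_comp (continuous_comp (@ladd_continuous (x ⊕ y) b)
  (@rsub_continuous y _)) (@rsub_continuous x _).
Qed.

Lemma nbhs_ladd x A : nbhs x A <-> nbhs gzero (gadd x @^-1` A).
Proof.
split=> [xA|A0].
  by apply: nbhs_preimage; [exact: ladd_continuous | rewrite gaddg0].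
rewrite (_ : A = gadd (⊖ x) @^-1` (gadd x @^-1` A)); last first.
  by apply/seteqP; split=> z /=; rewrite gaddNKg.
by apply: nbhs_preimage; [exact: ladd_continuous | rewrite gaddNg].
Qed.

(** For neighbourhoods [A] of 0 and [B] of [c], intersecting [A] with the preimage of [B] under
    [gadd c] yields a [c ⊕ b] in both. *)
Lemma hausdorff_gzero (c : G) : hausdorff_space G ->
  (forall A, nbhs gzero A -> exists2 b, A b & A (c ⊕ b)) -> c = gzero.
Proof.
move=> hG Hc; apply/esym/hG => A B A0 /nbhs_ladd Bc.
by have [b [_ Bcb] [Acb _]] := Hc _ (filterI A0 Bc); exists (c ⊕ b).
Qed.

(* Both conditions of the theorem, localized at one neighbourhood U: the
   sequence is subordinated to U, and the sets [V n ⊟ V n] intersect inside U. *)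
Definition controlled (U : set G) := exists V : nat -> set G,
  [/\ forall n, open_nbhs gzero (V n), forall m n, m <= n -> V n `<=` V m,
      forall x y, exists n, V n `<=` shift x y @^-1` U,
      forall x y, exists n, V n `<=` shift x y @` U &
      forall c, (forall n, exists2 b, V n b & V n (c ⊕ b)) -> U c].

Lemma controlled_omega_balanced :
  (forall U, nbhs gzero U -> controlled U) -> omega_balanced G.
Proof.
move=> cG U /cG [V [oV _ shV shVV _]]; exists (range V); split.
- exact: card_image_le.
- by move=> _ [n _ <-].
- split=> x y; last by have [n Vn] := shVV x y; exists (V n) => //; exists n.
  have [n Vn] := shV x y; exists (V n); first by exists n.
  by move=> _ [v /Vn ? <-].
Qed.

Lemma controlled_hausdorff_number :
  (forall U, nbhs gzero U -> controlled U) ->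
  hausdorff_number_bound G [set: nat].
Proof.
move=> cG U /cG [V [oV _ _ _ sepV]]; exists (range V); split.
- exact: card_image_le.
- by move=> _ [n _ <-]; apply: open_nbhs_nbhs.
- move=> c Hc; apply: sepV => n.
  have [|a Va [b Vb abc]] := Hc (V n); first by exists n.
  by exists b => //; rewrite (proj1 (cosub_eq _ _ _) abc).
Qed.

(** For an intersection, the sequences are intersected termwise; as both decrease, the larger of two
    indices serves both. *)
Lemma controlled_filter : Filter controlled.
Proof.
split.
- exists (fun=> setT); split=> // [n|x y|x y].
  + by split=> //; apply: openT.
  + by exists 0.
  + by exists 0; rewrite image_shift.
- move=> A B [V [oV decV shV shVV sepV]] [W [oW decW shW shWV sepW]].
  exists (fun n => V n `&` W n); split.
  + by move=> n; apply: open_nbhsI.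
  + by move=> m n mn z [/(decV _ _ mn) ? /(decW _ _ mn)].
  + move=> x y; have [m Vm] := shV x y; have [n Wn] := shW x y.
    exists (maxn m n) => z [/(decV _ _ (leq_maxl _ _)) /Vm ?].
    by move=> /(decW _ _ (leq_maxr _ _)) /Wn.
  + move=> x y; have [m Vm] := shVV x y; have [n Wn] := shWV x y.
    exists (maxn m n) => z [/(decV _ _ (leq_maxl _ _)) /Vm + ].
    move=> + /(decW _ _ (leq_maxr _ _)) /Wn; rewrite !image_shift.
    by split.
  + move=> c Hc; split; [apply: sepV | apply: sepW] => n;
      by have [b [? ?] [? ?]] := Hc n; exists b.
- move=> A B AB [V [oV decV shV shVV sepV]]; exists V; split=> //.
  + by move=> x y; have [n Vn] := shV x y; exists n => z /Vn /AB.
  + move=> x y; have [n Vn] := shVV x y; exists n.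
    by move=> z /Vn; rewrite !image_shift => /AB.
  + by move=> c /sepV /AB.
Qed.

End Paratopological.

(** The controlling sequence is the preimage of a decreasing base at 0 of [H]. *)
Lemma controlled_preimage (G H : paratopologicalGyrogroupType) (p : G -> H)
    (W : set H) :
  first_countable H -> hausdorff_space H ->
  {morph p : x y / x ⊕ y} -> continuous p ->
  nbhs gzero W -> controlled (p @^-1` W).
Proof.
move=> /(@first_countable_decr _ gzero)[O [oO decO baseO]] hH pD pc W0.
exists (fun n => p @^-1` O n); split.
- move=> n; have [Oo O0] := oO n; split; last by rewrite /= gmorph0.
  by move/continuousP: pc; apply.
- by move=> m n mn z /(decO _ _ mn).
- move=> x y; have [|n On] := baseO (shift (p x) (p y) @^-1` W).
    by apply: nbhs_preimage; [exact: shift_continuous | rewrite shift0].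
  by exists n => z /On; rewrite /= (gmorph_shift pD).
- move=> x y; have [|n On] := baseO (shiftV (p x) (p y) @^-1` W).
    by apply: nbhs_preimage; [exact: shiftV_continuous | rewrite shiftV0].
  by exists n => z /On; rewrite image_shift /= (gmorph_shiftV pD).
(* Hausdorffness of [H] forces [p c] to be 0, which lies in [W]. *)
- move=> c Hc /=; rewrite (_ : p c = gzero); first exact: nbhs_singleton.
  apply: hausdorff_gzero => // A /baseO [n On].
  have [b Ob Ocb] := Hc n.
  by exists (p b); [apply: On | rewrite -pD; apply: On].
Qed.

(** * Invariant neighbourhoods and the Hausdorff number *)

Lemma nbhs_gyr_invariant (G : stronglyParatopologicalGyrogroupType)
    (A : set G) :
  nbhs gzero A -> exists U, [/\ nbhs gzero U, U `<=` A &
    forall x y z, U (gyr x y z) <-> U z].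
Proof.
move=> A0; have [B [B0 Bbase] Bgyr] := @gyr_invariant_base G.
have [U BU UA] := Bbase _ A0; exists U; split=> //; first exact: B0.
move=> x y z; split=> [|Uz]; last by rewrite -(Bgyr _ BU x y); exists z.
by rewrite -{1}(Bgyr _ BU x y) => -[w Uw /(bij_inj (gyr_bij x y)) <-].
Qed.

Lemma hausdorff_number_bound_le (G : paratopologicalGyrogroupType) (T T' : Type)
    (K : set T) (K' : set T') :
  K #<= K' -> hausdorff_number_bound G K -> hausdorff_number_bound G K'.
Proof.
move=> KK' bK U /bK [gamma [gK g0 gU]]; exists gamma; split=> //.
exact: card_le_trans gK KK'.
Qed.

(** The minimum must be shown to exist: it is the least finite bound if there is one, and otherwise
    every bound is infinite, so [[set: nat]] is least. *)
Lemma hausdorff_number_le_nat (G : paratopologicalGyrogroupType) :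
  hausdorff_number_le G [set: nat] <-> hausdorff_number_bound G [set: nat].
Proof.
split=> [[T [K [[bK _] KN]]]|bN]; first exact: hausdorff_number_bound_le bK.
have [fin|nofin] := pselect (exists n, hausdorff_number_bound G `I_n).
  have finb : exists n, `[< hausdorff_number_bound G `I_n >].
    by have [n ?] := fin; exists n; apply/asboolP.
  case: (ex_minnP finb) => n /asboolP bn nmin.
  exists nat, `I_n; split; last exact: card_leT.
  split=> // T' K' bK'.
  have [/finite_setP[m]|/infiniteP K'inf] := pselect (finite_set K').
    rewrite card_eq_le => /andP[K'm mK']; apply: card_le_trans mK'.
    rewrite card_le_II; apply: nmin; apply/asboolP.
    exact: hausdorff_number_bound_le bK'.
  exact: card_le_trans (card_leT _) K'inf.
exists nat, [set: nat]; split=> //; split=> // T' K' bK'.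
apply/infiniteP => /finite_setP[m]; rewrite card_eq_le => /andP[K'm _].
by apply: nofin; exists m; apply: hausdorff_number_bound_le bK'.
Qed.

(** * Null sequences by iterated refinement *)

Section Refinement.
Context {G : stronglyParatopologicalGyrogroupType}.

Definition invariant_nbhs (U : set G) :=
  nbhs gzero U /\ forall x y z, U (gyr x y z) <-> U z.

(** One step of the construction: the clauses provide [nullseqD], [nullseq_shift], [nullseq_shiftV]
    and [nullseq_sep] respectively. *)
Definition refines (s : nat -> set G) (U : set G) :=
  [/\ exists k, forall v w, s k v -> s k w -> U (v ⊕ w),
      forall x y, exists k, s k `<=` shift x y @^-1` U,
      forall x y, exists k, s k `<=` shift x y @` U &
      forall c, (forall k, exists2 b, s k b & s k (c ⊕ b)) -> U c].

Hypothesis balanced : omega_balanced G.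
Hypothesis Hs_nat : hausdorff_number_bound G [set: nat].

(** [e] enumerates a subordinated family, [d] a family given by the Hausdorff number, and [A], [B]
    come from continuity at 0; [s k] is an invariant neighbourhood inside all four. *)
Lemma exists_refines U : nbhs gzero U ->
  exists s, (forall k, invariant_nbhs (s k)) /\ refines s U.
Proof.
move=> U0.
have [gam [/(countable_enum setT)[e [egam game] gam0 [subU Usub]]]] :=
  balanced U0.
have [del [/(countable_enum setT)[d [ddel deld] del0 capU]]] := Hs_nat U0.
have [A [B [A0 B0 ABU]]] : exists A B : set G, [/\ nbhs gzero A, nbhs gzero B &
    forall u w, A u -> B w -> U (u ⊕ w)].
  by apply: nbhs_add; rewrite gadd0g.
have e0 k : nbhs gzero (e k).
  by case: (egam k) => [/gam0/open_nbhs_nbhs|->] //; apply: filterT.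
have d0 k : nbhs gzero (d k).
  by case: (ddel k) => [/del0|->] //; apply: filterT.
have /choice[s sP] k : exists S, [/\ nbhs gzero S,
    S `<=` (e k `&` d k) `&` (A `&` B) & forall x y z, S (gyr x y z) <-> S z].
  by apply: nbhs_gyr_invariant; do 2?apply: filterI.
have se k : s k `<=` e k by have [_ sk _] := sP k; move=> z /sk [[]].
have sd k : s k `<=` d k by have [_ sk _] := sP k; move=> z /sk [[]].
exists s; split=> [k|]; first by have [] := sP k.
split.
- exists 0 => v w; have [_ s0 _] := sP 0.
  by move=> /s0 [_ [Av _]] /s0 [_ [_ Bw]]; apply: ABU.
- move=> x y; have [V gV VU] := subU x y; have [k ek] := game V gV.
  by exists k => z /se; rewrite ek => Vz; apply: VU; exists z.
- move=> x y; have [V gV VU] := Usub x y; have [k ek] := game V gV.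
  by exists k => z /se; rewrite ek => /VU.
- move=> c Hc; apply: capU => V /deld [k dk].
  have [b sb scb] := Hc k; exists (c ⊕ b); first by rewrite -dk; apply: sd.
  by exists b; [rewrite -dk; apply: sd | apply/cosub_eq].
Qed.

(** Closing one invariant set under refinement gives a countable family; its initial finite
    intersections form the sequence. *)
Lemma exists_nullseq U : nbhs gzero U ->
  exists V : nullseq G, (forall n, nbhs gzero (V n)) /\ exists n, V n `<=` U.
Proof.
move=> /nbhs_gyr_invariant [U0 [U00 U0U U0gyr]].
(* The constant [setT] only makes [S] total. *)
have /choice[S SP] W : exists s, invariant_nbhs W ->
    (forall k, invariant_nbhs (s k)) /\ refines s W.
  have [[W0 _]|noW] := pselect (invariant_nbhs W); last by exists (fun=> setT).
  by have [s sW] := exists_refines W0; exists s.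
(* The orbit of U0 under refinement, indexed by the codes of finite paths. *)
pose T := fix T (l : seq nat) := if l is k :: l' then S (T l') k else U0.
have Tinv l : invariant_nbhs (T l).
  by elim: l => [|k l IHl] //=; have [] := SP _ IHl.
have Tref l : refines (S (T l)) (T l) by have [] := SP _ (Tinv l).
(* Numbers that code no path stand for the empty path, that is for [U0]. *)
pose e n := T (odflt [::] (unpickle n)).
have eP n : exists l, e n = T l by eexists.
have capT l : capn e (pickle l) `<=` T l.
  by move=> z /(_ _ (ltnSn _)); rewrite /e pickleK.
pose V := capn e.
have V_gyr n x y z : V n (gyr x y z) <-> V n z.
  by split=> Vz k kn; have [_ eg] := Tinv (odflt [::] (unpickle k));
    apply/(eg x y)/Vz.
(* A requirement on [e k] is met by some child [S (T l) j], hence by [V] at the code of [j :: l];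
   [uniform_bound] then treats all [k <= n] at once. *)
have V_bound (Q : nat -> set G -> Prop) :
    (forall k A B, A `<=` B -> Q k B -> Q k A) ->
    (forall k l, e k = T l -> exists j, Q k (S (T l) j)) ->
    forall n, exists m, forall k, k <= n -> Q k (V m).
  move=> Qmono Qex; apply: uniform_bound => [k m m' mm'|k].
    by apply: Qmono; apply: capn_decr.
  have [l el] := eP k; have [j Qj] := Qex k l el.
  by exists (pickle (j :: l)); apply: Qmono Qj; apply: (capT (j :: l)).
have V_D n : exists m, forall v w, V m v -> V m w -> V n (v ⊕ w).
  have [|k l el|m Vm] := V_bound
    (fun k A => forall v w, A v -> A w -> e k (v ⊕ w)) _ _ n.
  - by move=> k A B AB HB v w /AB + /AB; apply: HB.
  - by have [[j Sj] _ _ _] := Tref l; exists j => v w; rewrite el; apply: Sj.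
  - by exists m => v w Vv Vw k kn; apply: (Vm k kn).
have V_shift n x y : exists m, V m `<=` shift x y @^-1` V n.
  have [|k l el|m Vm] := V_bound
    (fun k A => A `<=` shift x y @^-1` e k) _ _ n.
  - by move=> k A B AB; apply: subset_trans.
  - by rewrite el; have [_ + _ _] := Tref l; apply.
  - by exists m => v Vv k kn; apply: (Vm k kn).
have V_shiftV n x y : exists m, V m `<=` shift x y @` V n.
  have [|k l el|m Vm] := V_bound
    (fun k A => A `<=` shift x y @` e k) _ _ n.
  - by move=> k A B AB; apply: subset_trans.
  - by rewrite el; have [_ _ + _] := Tref l; apply.
  - exists m => v Vv; rewrite image_shift => k kn.
    by have := Vm k kn v Vv; rewrite image_shift.
have V_sep c : (forall m, exists2 b, V m b & V m (c ⊕ b)) -> forall n, V n c.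
  move=> Hc n k _; have [l ->] := eP k.
  have [_ _ _] := Tref l; apply=> j.
  by have [b Vb Vcb] := Hc (pickle (j :: l)); exists b; apply: (capT (j :: l)).
have V_0 n : nbhs gzero (V n).
  apply: (@capn_closed _ e (nbhs gzero)) => [A B|k]; first exact: filterI.
  by have [l ->] := eP k; have [] := Tinv l.
exists (Nullseq (fun n => nbhs_singleton (V_0 n)) (@capn_decr _ e) V_gyr V_D
  V_shift V_shiftV V_sep); split=> //.
by exists (pickle (Nil nat)) => z /(capT [::]) /U0U.
Qed.

End Refinement.

(** * Neighbourhoods in quotients, products and subspaces *)

Lemma kpi_continuous (G : paratopologicalGyrogroupType) (V : nullseq G) :
  (forall n, nbhs gzero (V n)) -> continuous (kpi V).
Proof.
move=> V0 x A /nbhs_kpi [n An]; apply: filterS An _.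
apply/nbhs_ladd; apply: filterS (V0 n) => v Vv.
by rewrite /= /near_at gaddKg.
Qed.

(** Saturating under inseparability costs one use of [near_at_trans]. *)
Lemma kpi_nbhs_near (G : topologizedGyrogroupType) (V : nullseq G) n (x : G) :
  exists2 W, nbhs (kpi V x) W & kpi V @^-1` W `<=` near_at V n x.
Proof.
have [m Hm] := near_at_trans V n.
exists (kpi V @` near_at V m x).
  by apply/nbhs_kpi; exists m => y ?; exists y.
by move=> z [y xy /kpi_eq/asboolP /(_ m)]; apply: Hm.
Qed.

Section ProductTopology.
Context (I : Type) (K : I -> topologicalType).

Lemma prod_eval_continuous i : continuous (fun f : prod_topology K => f i).
Proof.
move=> f A fA; have /cvg_sup/(_ i) : nbhs f --> f by [].
apply; exact: (@initial_continuous _ _ (fun g : prod_topology K => g i)) fA.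
Qed.

(** The product is a supremum of initial topologies, so convergence is tested one coordinate at a
    time. *)
Lemma cvg_prod_topology (F : set_system (prod_topology K))
    (f : prod_topology K) :
  Filter F -> (forall i, (fun g => g i) @ F --> f i) -> F --> f.
Proof.
move=> FF Ff; apply/cvg_sup => i A [_ [[B Bo <-] Bf BA]].
by apply: filterS BA _; apply: Ff; apply: open_nbhs_nbhs.
Qed.

End ProductTopology.

Lemma nbhs_set_type (T : topologicalType) (A : set T) (a : A) (B : set A) :
  nbhs a B <-> exists2 O, nbhs (set_val a) O & set_val @^-1` O `<=` B.
Proof.
split=> [[_ [[O Oo <-] Oa OB]]|[O Oa OB]].
  by exists O => //; apply: open_nbhs_nbhs.
apply: filterS OB _; exact: (@initial_continuous A T set_val) Oa.
Qed.

(** * Necessity: subgyrogroups of products *)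

Section EmbeddedGyrogroup.
Context (G : stronglyParatopologicalGyrogroupType) (I : Type)
  (H : I -> stronglyParatopologicalGyrogroupType)
  (A : subgyrogroup (prod_topology H)).
Hypothesis fcH : forall i, first_countable (H i).
Hypothesis hH : forall i, hausdorff_space (H i).
Hypothesis isoG : topologically_isomorphic G (set_type A).

Let coord_continuous (f : G -> set_type A) i :
  continuous f -> continuous (fun x => set_val (f x) i).
Proof.
move=> fc x; exact: continuous_comp (continuous_comp (fc x)
  (@initial_continuous _ _ (@set_val _ A) _)) (@prod_eval_continuous _ H i _).
Qed.

Lemma embedded_hausdorff : hausdorff_space G.
Proof.
have [f [g [fK gK fD fc gc]]] := isoG.
move=> p q clpq; apply: (can_inj fK); apply: val_inj.
apply: functional_extensionality_dep => i; apply: hH => B C pB qC.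
have cont := @coord_continuous f i fc.
have [x [xB xC]] := clpq _ _ (nbhs_preimage cont pB) (nbhs_preimage cont qC).
by exists (set_val (f x) i).
Qed.

Lemma embedded_controlled (U : set G) : nbhs gzero U -> controlled U.
Proof.
have [f [g [fK gK fD fc gc]]] := isoG.
move=> U0; have f0 := gmorph0 fD.
have /nbhs_set_type[O O0 OU] : nbhs (f gzero) (g @^-1` U).
  by apply: nbhs_preimage; [exact: gc | rewrite fK].
pose h x : prod_topology H := set_val (f x).
have hO : controlled (h @^-1` O).
  have FF := @controlled_filter G.
  (* Viewed as convergence of this filter to [h gzero], the claim reduces to single coordinates. *)
  have FH : Filter [set S | controlled (h @^-1` S)].
    exact: (fmap_filter h FF).
  apply: (@cvg_prod_topology _ _ _ (h gzero) FH) O0 => i W W0.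
  apply: (@controlled_preimage _ _ (fun x => h x i) _ (@fcH i) (@hH i)).
  - by move=> x y; rewrite /h fD.
  - exact: coord_continuous.
  - by move: W0; rewrite /h f0.
have FF := @controlled_filter G.
by apply: filterS hO => x /OU; rewrite /= fK.
Qed.

End EmbeddedGyrogroup.

(** * Sufficiency: the diagonal embedding *)

Section Embedding.
Context (G : stronglyParatopologicalGyrogroupType).
Hypothesis hG : hausdorff_space G.
Hypothesis balanced : omega_balanced G.
Hypothesis Hs_nat : hausdorff_number_bound G [set: nat].

Let I := {U : set G | nbhs gzero U}.

Let nseq (i : I) : nullseq G :=
  projT1 (cid (exists_nullseq balanced Hs_nat (svalP i))).

Let nseqP (i : I) : (forall n, nbhs gzero (nseq i n)) /\
    exists n, nseq i n `<=` sval i :=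
  projT2 (cid (exists_nullseq balanced Hs_nat (svalP i))).

Definition factor (i : I) : stronglyParatopologicalGyrogroupType :=
  kquot (nseq i).

Definition diag (x : G) : prod_topology factor := fun i => kpi (nseq i) x.

Let diagD : {morph diag : x y / x ⊕ y}.
Proof.
by move=> x y; apply: functional_extensionality_dep => i; apply: kpiD.
Qed.

Let diag_neq0 : range diag !=set0.
Proof. by exists (diag gzero); exists gzero. Qed.

Let diag_add x y : range diag x -> range diag y -> range diag (x ⊕ y).
Proof. by move=> [a _ <-] [b _ <-]; exists (a ⊕ b). Qed.

Let diag_opp x : range diag x -> range diag (⊖ x).
Proof. by move=> [a _ <-]; exists (⊖ a) => //; rewrite (gmorphN diagD). Qed.

Definition diag_subgyrogroup : subgyrogroup (prod_topology factor) :=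
  Subgyrogroup diag_neq0 diag_add diag_opp.

(** One coordinate suffices: the one indexed by [A] translated back to 0. This yields both
    injectivity of [diag] and continuity of its inverse. *)
Let diag_nbhs x A : nbhs x A ->
  exists2 W, nbhs (diag x) W & diag @^-1` W `<=` A.
Proof.
move=> /nbhs_ladd A0; pose i : I := exist _ _ A0.
have [_ [n nA]] := nseqP i; have [W W0 WV] := kpi_nbhs_near (nseq i) n x.
exists ((fun f : prod_topology factor => f i) @^-1` W).
  exact: (@prod_eval_continuous _ factor).
by move=> z /WV /nA /=; rewrite gaddNKg.
Qed.

Let diag_inj : injective diag.
Proof.
move=> x y xy; apply: hG => A B /diag_nbhs[W xW WA] yB; exists y.
split; last exact: nbhs_singleton.
by apply: WA; rewrite /= -xy; apply: nbhs_singleton.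
Qed.

Let diag_continuous : continuous diag.
Proof.
move=> x; apply: cvg_prod_topology => i A xA.
exact: (kpi_continuous (nseqP i).1) xA.
Qed.

Lemma diag_isomorphic : topologically_isomorphic G (set_type diag_subgyrogroup).
Proof.
pose f (x : G) : set_type diag_subgyrogroup :=
  exist _ (diag x) (mem_set (imageT diag x)).
have /choice[g gP] (b : set_type diag_subgyrogroup) : exists x, diag x = val b.
  by have [x _ xb] := set_valP b; exists x.
have fgK : cancel g f by move=> b; apply: val_inj; rewrite /= gP.
exists f, g; split=> //.
- by move=> x; apply: diag_inj; rewrite gP.
- by move=> x y; apply: val_inj; apply: diagD.
- move=> x A /nbhs_set_type [O xO OA].
  apply: filterS (nbhs_preimage diag_continuous xO) => z Oz.
  exact: OA.
- move=> b A /diag_nbhs [W bW WA]; apply/nbhs_set_type.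
  exists W; first by move: bW; rewrite gP.
  by move=> c Wc; apply: WA; rewrite /= gP.
Qed.

End Embedding.

Theorem theorem3p25 (G : stronglyParatopologicalGyrogroupType) :
  (exists (I : Type) (H : I -> stronglyParatopologicalGyrogroupType)
          (A : subgyrogroup (prod_topology H)),
      (forall i, first_countable (H i) /\ hausdorff_space (H i)) /\
      topologically_isomorphic G (set_type A)) <->
  [/\ hausdorff_space G, omega_balanced G & hausdorff_number_le G [set: nat]].
Proof.
split=> [[I [H [A [H_ isoG]]]]|[hG balanced /hausdorff_number_le_nat Hs_nat]].
  have fcH i := (H_ i).1; have hH i := (H_ i).2.
  have cG := @embedded_controlled _ _ _ _ fcH hH isoG.
  split; first exact: embedded_hausdorff isoG.
    exact: controlled_omega_balanced.
  by apply/hausdorff_number_le_nat; apply: controlled_hausdorff_number.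
exists _, (factor balanced Hs_nat), (diag_subgyrogroup balanced Hs_nat).
split; last exact: diag_isomorphic.
by move=> i; split; [apply: kquot_first_countable | apply: kquot_hausdorff].
Qed.
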